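(* For every $\mathbf{K}\in\mathcal{K}$, $$\big\langle \nabla^{\star}\mathcal{J}(\mathbf{K}),\,\mathbf{K}-\mathbf{K}^\star \big\rangle \ge \big(\mathcal{J}(\mathbf{K})-\mathcal{J}^\star\big) + \underline{\lambda}\,\lVert\mathbf{K}-\mathbf{K}^\star\rVert^2,\qquad \underline{\lambda}=\lambda_{\min}(G_w)\,\lambda_{\min}(\Sigma_0)\,\lambda_{\min}(R)>0.$$
   Context: Setting. $\{\rho_1,\dots,\rho_S\}$ is a finite grid with weights $\nu_s>0$, $\sum_{s=1}^S\nu_s=1$. $w_1,\dots,w_N$ are continuous weighting functions with $w_i(\rho)\ge 0$ and $\sum_{i=1}^N w_i(\rho)=1$; $A(\rho)=\sum_i w_i(\rho)A_i$ and $B(\rho)=\sum_i w_i(\rho)B_i$ with $A_i\in\mathbb{R}^{n\times n}$, $B_i\in\mathbb{R}^{n\times m}$. The matrices $Q,\Sigma_0\in\mathbb{R}^{n\times n}$ and $R\in\mathbb{R}^{m\times m}$ are symmetric positive definite. A gain $K\in\mathbb{R}^{m\times n}$ stabilizes plant $s$ if $A_{\mathrm{cl}}=A(\rho_s)-B(\rho_s)K$ is Schur stable (spectral radius $<1$). For such $K$: $P$ is the solution of $P=A_{\mathrm{cl}}^\top P A_{\mathrm{cl}}+Q+K^\top RK$; $\Sigma$ is the solution of $\Sigma=A_{\mathrm{cl}}\Sigma A_{\mathrm{cl}}^\top+\Sigma_0$; $J_s(K)=\operatorname{tr}(P\Sigma_0)$; $H=R+B(\rho_s)^\top PB(\rho_s)$;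 $E=HK-B(\rho_s)^\top PA(\rho_s)$. A schedule is a tuple $\mathbf{K}=(K_1,\dots,K_N)$ of matrices in $\mathbb{R}^{m\times n}$; its deployed gain at grid point $s$ is $K_{\mathbf{K}}(\rho_s)=\sum_i w_i(\rho_s)K_i$. The feasible set is $\mathcal{K}=\{\mathbf{K}: K_{\mathbf{K}}(\rho_s)\text{ stabilizes plant } s,\ s=1,\dots,S\}$, and the scheduled cost is $\mathcal{J}(\mathbf{K})=\sum_s\nu_s J_s(K_{\mathbf{K}}(\rho_s))$ on $\mathcal{K}$. Write $P_s,\Sigma_s,E_s,H_s$ for the matrices $P,\Sigma,E,H$ of plant $s$ at the deployed gain $K=K_{\mathbf{K}}(\rho_s)$. Standing assumptions: $\mathcal{K}\ne\emptyset$ and $G_w=\sum_s\nu_s w(\rho_s)w(\rho_s)^\top\succ0$, where $w(\rho)=(w_1(\rho),\dots,w_N(\rho))^\top$. Under these, $\mathcal{J}$ attains its minimum over $\mathcal{K}$; $\mathbf{K}^\star\in\mathcal{K}$ denotes a fixed minimizer, $\mathcal{J}^\star=\mathcal{J}(\mathbf{K}^\star)$, and $\Sigma_s^\star$ is the covariance $\Sigma$ of plant $s$ at the gain $K_{\mathbf{K}^\star}(\rho_s)$. The inner product is $\langle X,Y\rangle=\operatorname{tr}(X^\top Y)$, summed over the tuple; $\lVert\cdot\rVert$ is the induced (Frobenius) norm; $\lambda_{\min}$ is the smallest eigenvalue of a symmetric matrix. The starred gradient $\nabla^{\star}\mathcal{J}(\mathbf{K})$ is the tuple with blocks $\nabla^{\star}_{K_i}\mathcal{J}(\mathbf{K})=2\sum_s\nu_s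 w_i(\rho_s)E_s\Sigma_s^\star$, $i=1,\dots,N$ (with $E_s$ evaluated at $\mathbf{K}$). *)

(* Defs.v *)
From HB Require Import structures.
From mathcomp Require Import all_boot all_order all_algebra.
From mathcomp Require Import complex.
From mathcomp Require Import all_classical all_reals all_analysis.

Set Implicit Arguments.
Unset Strict Implicit.
Unset Printing Implicit Defensive.

Import Order.TTheory GRing.Theory Num.Theory.
Import numFieldNormedType.Exports.

Local Open Scope classical_set_scope.
Local Open Scope ring_scope.

Definition posdefmx (R : realType) (n : nat) (M : 'M[R]_n) : Prop :=
  M^T = M /\ forall v : 'cV[R]_n, v != 0 -> 0 < (v^T *m M *m v) 0 0.

(* For symmetric M with 0 < n the set of real eigenvalues is finite and
   nonempty, so this infimum is the minimum. *)
Definition lambda_min (R : realType) (n : nat) (M : 'M[R]_n) : R :=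
  inf [set a | eigenvalue M a].

(* The eigenvalues are taken in R[i]; their set is finite, and nonempty when
   0 < n, so this supremum is the largest modulus. *)
Definition spectral_radius (R : realType) (n : nat) (M : 'M[R]_n) : R :=
  sup [set Normc.normc z | z in
        [set z : R[i] | eigenvalue (map_mx (real_complex R) M) z]].

Definition schur_stable (R : realType) (n : nat) (M : 'M[R]_n) : Prop :=
  spectral_radius M < 1.

(* The solution X of X = F^T X F + W.  It exists and is unique when F is Schur
   stable; the value is only meaningful in that case. *)
Definition dlyap (R : realType) (n : nat) (F W : 'M[R]_n) : 'M[R]_n :=
  xget 0 [set X | X = F^T *m X *m F + W].

Section Plant.
Variables (R : realType) (n m : nat).
Variables (A : 'M[R]_n) (B : 'M[R]_(n, m)).
Variables (Q : 'M[R]_n) (Rc : 'M[R]_m) (Sigma0 : 'M[R]_n).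
Variable K : 'M[R]_(m, n).

Definition Acl : 'M[R]_n := A - B *m K.

Definition stabilizes : Prop := schur_stable Acl.

Definition Pmx : 'M[R]_n := dlyap Acl (Q + K^T *m Rc *m K).

(* Sigma = Acl Sigma Acl^T + Sigma0 *)
Definition Sigmamx : 'M[R]_n := dlyap Acl^T Sigma0.

Definition plant_cost : R := \tr (Pmx *m Sigma0).

Definition Hmx : 'M[R]_m := Rc + B^T *m Pmx *m B.

Definition Emx : 'M[R]_(m, n) := Hmx *m K - B^T *m Pmx *m A.

End Plant.

(* sum_i w_i(r) X_i: used for A(r), B(r) and for the deployed gain. *)
Definition blend (R : realType) (T : Type) (N p q : nat) (w : 'I_N -> T -> R)
    (X : {ffun 'I_N -> 'M[R]_(p, q)}) (r : T) : 'M[R]_(p, q) :=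
  \sum_i w i r *: X i.

(* Indices: T is the parameter domain, n states, m inputs, N vertices,
   S grid points. *)
Record scheduled_lqr (R : realType) (T : topologicalType) (n m N S : nat) :=
  ScheduledLqr {
    grid : 'I_S -> T;
    nu : 'I_S -> R;
    wt : 'I_N -> T -> R;
    Avert : {ffun 'I_N -> 'M[R]_n};
    Bvert : {ffun 'I_N -> 'M[R]_(n, m)};
    Qcost : 'M[R]_n;
    Rcost : 'M[R]_m;
    Sigma0 : 'M[R]_n
  }.

Section Schedule.
Variables (R : realType) (T : topologicalType) (n m N S : nat).
Variable D : scheduled_lqr R T n m N S.

Notation schedule := {ffun 'I_N -> 'M[R]_(m, n)}.

Definition Agrid (s : 'I_S) : 'M[R]_n := blend (wt D) (Avert D) (grid D s).

Definition Bgrid (s : 'I_S) : 'M[R]_(n, m) :=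
  blend (wt D) (Bvert D) (grid D s).

Definition gain (K : schedule) (s : 'I_S) : 'M[R]_(m, n) :=
  blend (wt D) K (grid D s).

Definition feasible : set schedule :=
  [set K | forall s, stabilizes (Agrid s) (Bgrid s) (gain K s)].

Definition cost (K : schedule) : R :=
  \sum_s nu D s *
    plant_cost (Agrid s) (Bgrid s) (Qcost D) (Rcost D) (Sigma0 D) (gain K s).

Definition minimizer (Kstar : schedule) : Prop :=
  feasible Kstar /\ forall K, feasible K -> cost Kstar <= cost K.

Definition E_at (K : schedule) (s : 'I_S) : 'M[R]_(m, n) :=
  Emx (Agrid s) (Bgrid s) (Qcost D) (Rcost D) (gain K s).

Definition Sigma_at (K : schedule) (s : 'I_S) : 'M[R]_n :=
  Sigmamx (Agrid s) (Bgrid s) (Sigma0 D) (gain K s).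

Definition wvec (r : T) : 'cV[R]_N := \col_i wt D i r.

Definition Gw : 'M[R]_N :=
  \sum_s nu D s *: (wvec (grid D s) *m (wvec (grid D s))^T).

(* The error matrices are those of K, the covariances those of Kstar. *)
Definition star_grad (Kstar K : schedule) : schedule :=
  [ffun i => 2 *: \sum_s (nu D s * wt D i (grid D s)) *:
                           (E_at K s *m Sigma_at Kstar s)].

End Schedule.

Definition tuple_dot (R : realType) (N p q : nat)
    (X Y : {ffun 'I_N -> 'M[R]_(p, q)}) : R :=
  \sum_i \tr ((X i)^T *m Y i).

Definition tuple_norm (R : realType) (N p q : nat)
    (X : {ffun 'I_N -> 'M[R]_(p, q)}) : R :=
  Num.sqrt (tuple_dot X X).

(* Main.v *)
Require Import Defs.
From HB Require Import structures.
From mathcomp Require Import all_boot all_order all_algebra.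
From mathcomp Require Import complex.
From mathcomp Require Import all_classical all_reals all_analysis.
From mathcomp Require Import ring.
Import Order.TTheory GRing.Theory Num.Theory.
Import numFieldNormedType.Exports.
Local Open Scope classical_set_scope.
Local Open Scope ring_scope.

(** For a single plant, put D = K - K', let P, H, E be the matrices of K and X
    the covariance of K'.  Expanding the Lyapunov equation of P in the closed
    loop of K' and pairing with X gives
      J(K) - J(K') = 2 tr((E X)^T D) - tr(D^T H D X),
    and tr(D^T H D X) >= lambda_min(R) lambda_min(Sigma0) |D|^2 because
    H - R and X - Sigma0 are positive semidefinite.  It remains to average over
    the grid and to bound the weighted sum of the squared deployed differences
    below by lambda_min(G_w) |K - K'|^2.

    Schur stability enters only through the bound
      sum_(j < k) |F^j| <= B for all k,
    which follows from Cayley-Hamilton over the complex numbers.  It yields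
    solvability, uniqueness and positivity of Lyapunov equations by the
    archimedean property: a constant (or a lower bound) of the terms of a
    series with bounded partial sums must be <= 0. *)

(** * Lyapunov equations with summable powers *)

Section RealMatrices.
Set Implicit Arguments.
Unset Strict Implicit.
Variable R : realType.

(** The entrywise l1 norm, chosen because it is submultiplicative for rectangular products,
    invariant under transposition, and dominates every entry. *)
Definition sumnorm (p q : nat) (M : 'M[R]_(p, q)) : R := \sum_i \sum_j `|M i j|.

Lemma sumnorm_ge0 (p q : nat) (M : 'M[R]_(p, q)) : 0 <= sumnorm M.
Proof. by apply: sumr_ge0 => i _; apply: sumr_ge0. Qed.

Lemma ler_sumnorm (p q : nat) (M : 'M[R]_(p, q)) i j : `|M i j| <= sumnorm M.
Proof.
rewrite /sumnorm (bigD1 i)//= (bigD1 j)//= -addrA lerDl addr_ge0 ?sumr_ge0//.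
by move=> k _; apply: sumr_ge0.
Qed.

Lemma sumnorm_tr (p q : nat) (M : 'M[R]_(p, q)) : sumnorm M^T = sumnorm M.
Proof.
rewrite /sumnorm exchange_big; apply: eq_bigr => i _.
by apply: eq_bigr => j _; rewrite mxE.
Qed.

Lemma sumnormM (p q r : nat) (M : 'M[R]_(p, q)) (N : 'M[R]_(q, r)) :
  sumnorm (M *m N) <= sumnorm M * sumnorm N.
Proof.
rewrite {1 2}/sumnorm mulr_suml; apply: ler_sum => i _.
apply: (@le_trans _ _ (\sum_j \sum_k `|M i k| * `|N k j|)).
  apply: ler_sum => j _; rewrite mxE (le_trans (ler_norm_sum _ _ _))//.
  by apply: ler_sum => k _; rewrite normrM.
rewrite exchange_big mulr_suml; apply: ler_sum => k _.
rewrite -mulr_sumr ler_wpM2l// /sumnorm (bigD1 k)//= lerDl sumr_ge0//.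
by move=> l _; apply: sumr_ge0.
Qed.

Definition power_summable (n : nat) (F : 'M[R]_n) : Prop :=
  exists B, forall k, \sum_(j < k) sumnorm (F ^+ j) <= B.

Lemma trmx_exp (n : nat) (F : 'M[R]_n) k : (F ^+ k)^T = F^T ^+ k.
Proof.
elim: k => [|k IH]; first by rewrite !expr0 trmx1.
by rewrite exprS exprSr trmx_mul IH.
Qed.

Lemma power_summable_tr (n : nat) (F : 'M[R]_n) :
  power_summable F -> power_summable F^T.
Proof.
move=> [B FB]; exists B => k; apply: le_trans (FB k).
by apply: ler_sum => j _; rewrite -trmx_exp sumnorm_tr.
Qed.

(** Each single norm of a power is itself at most [B], so the left factor goes into the constant and
    only the right factor is summed. *)
Lemma power_summable_conj (n : nat) (F X : 'M[R]_n) : power_summable F ->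
  exists B, forall k,
    \sum_(j < k) sumnorm ((F ^+ j)^T *m X *m F ^+ j) <= B.
Proof.
move=> [B FB]; exists (B * sumnorm X * B) => k.
have F1 j : sumnorm (F ^+ j) <= B.
  apply: le_trans (FB j.+1); rewrite big_ord_recr lerDr sumr_ge0// => i _.
  exact: sumnorm_ge0.
have B0 : 0 <= B by apply: le_trans (FB 0%N); rewrite big_ord0.
have X0 := sumnorm_ge0 X.
apply: (@le_trans _ _ (\sum_(j < k) B * sumnorm X * sumnorm (F ^+ j))).
  apply: ler_sum => j _; apply: le_trans (sumnormM _ _) _.
  apply: ler_wpM2r; first exact: sumnorm_ge0.
  apply: le_trans (sumnormM _ _) _.
  by rewrite sumnorm_tr ler_wpM2r.
by rewrite -mulr_sumr ler_wpM2l// mulr_ge0.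
Qed.

Lemma ler_of_mulrn_bounded (x B : R) : (forall k, k%:R * x <= B) -> x <= 0.
Proof.
move=> xB; rewrite leNgt; apply/negP => x0.
have := archi_boundP (normr_ge0 (B / x)).
rewrite ltNge => /negP; apply; apply: le_trans (ler_norm _).
by rewrite ler_pdivlMr.
Qed.

Lemma stein_conj_exp (n : nat) (F X W : 'M[R]_n) k : X = F^T *m X *m F + W ->
  X = (F ^+ k)^T *m X *m F ^+ k + \sum_(j < k) (F ^+ j)^T *m W *m F ^+ j.
Proof.
move=> XE; elim: k => [|k IH].
  by rewrite big_ord0 addr0 expr0 trmx1 mul1mx mulmx1.
have -> : (F ^+ k.+1)^T *m X *m F ^+ k.+1 =
    (F ^+ k)^T *m (F^T *m X *m F) *m F ^+ k.
  by rewrite exprS trmx_mul !mulmxA.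
by rewrite big_ord_recr/= addrCA -mulmxDl -mulmxDr -XE addrC.
Qed.

(** [X] equals each of its conjugates by powers of [F], so [k] times the modulus of any entry stays
    below a fixed bound. *)
Lemma stein_homogeneous_eq0 (n : nat) (F X : 'M[R]_n) : power_summable F ->
  X = F^T *m X *m F -> X = 0.
Proof.
move=> /(power_summable_conj X) [B FB] XE.
have XEk k : X = (F ^+ k)^T *m X *m F ^+ k.
  have := @stein_conj_exp n F X 0 k; rewrite addr0 => /(_ XE) {1}->.
  by rewrite big1 ?addr0// => j _; rewrite mulmx0 mul0mx.
apply/matrixP => i j; rewrite mxE; apply/eqP; rewrite -normr_le0.
apply: (ler_of_mulrn_bounded (B := B)) => k; apply: le_trans (FB k).
rewrite mulr_natl -[X in _ *+ X](card_ord k) -sumr_const; apply: ler_sum => l _.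
by rewrite -XEk ler_sumnorm.
Qed.

Lemma dlyap_unique (n : nat) (F W X Y : 'M[R]_n) : power_summable F ->
  X = F^T *m X *m F + W -> Y = F^T *m Y *m F + W -> X = Y.
Proof.
move=> FS XE YE; apply/eqP; rewrite -subr_eq0; apply/eqP.
apply: (stein_homogeneous_eq0 (F := F)) => //.
by rewrite {1}XE {1}YE mulmxBr mulmxBl opprD addrACA subrr addr0.
Qed.

(* The Stein operator X |-> X - F^T X F is injective on a finite-dimensional
   space, hence onto. *)
Lemma dlyapP (n : nat) (F W : 'M[R]_n) : power_summable F ->
  dlyap F W = F^T *m dlyap F W *m F + W.
Proof.
move=> FS; suff [X XE] : exists X, X = F^T *m X *m F + W.
  by rewrite /dlyap; case: xgetP => [Y _ //|/(_ X)/=]; rewrite -XE.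
pose L (X : 'M[R]_n) := X - F^T *m X *m F.
have Llin : linear L.
  move=> a X Y; rewrite /L mulmxDr mulmxDl -scalemxAr -scalemxAl.
  by rewrite scalerBr opprD addrACA.
pose LL := GRing.isLinear.Build _ _ _ _ L Llin.
pose L' : {linear 'M[R]_n -> 'M[R]_n} := HB.pack L LL.
have Linj : row_free (lin_mx L').
  rewrite -kermx_eq0; apply/rowV0P => v /sub_kermxP.
  rewrite -[v]vec_mxK mul_vec_lin => /(congr1 vec_mx).
  rewrite mxvecK raddf0 => /eqP; rewrite subr_eq0 => /eqP LE.
  by rewrite (stein_homogeneous_eq0 FS LE) raddf0.
exists (vec_mx (mxvec W *m invmx (lin_mx L'))).
set X := vec_mx _; apply/eqP; rewrite addrC -subr_eq; apply/eqP.
rewrite -[LHS]/(L' X); apply: (can_inj mxvecK).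
by rewrite -mul_vec_lin vec_mxK mulmxKV// -row_free_unit.
Qed.

Lemma dlyap_sym (n : nat) (F W : 'M[R]_n) : power_summable F -> W^T = W ->
  (dlyap F W)^T = dlyap F W.
Proof.
move=> FS WT; apply: (dlyap_unique (F := F) (W := W)) => //; last exact: dlyapP.
by rewrite {1}dlyapP// linearD/= !trmx_mul trmxK WT mulmxA.
Qed.

(** * Positive semidefinite matrices and positivity of Lyapunov solutions *)

Definition psdmx (n : nat) (M : 'M[R]_n) : Prop :=
  M^T = M /\ forall v : 'cV[R]_n, 0 <= (v^T *m M *m v) 0 0.

Lemma posdef_psd (n : nat) (M : 'M[R]_n) : posdefmx M -> psdmx M.
Proof.
move=> [MT Mpos]; split=> // v; have [->|v0] := eqVneq v 0.
  by rewrite mulmx0 mxE.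
exact/ltW/Mpos.
Qed.

Lemma psdmxD (n : nat) (M N : 'M[R]_n) : psdmx M -> psdmx N -> psdmx (M + N).
Proof.
move=> [MT M0] [NT N0]; split; first by rewrite linearD/= MT NT.
by move=> v; rewrite mulmxDr mulmxDl mxE addr_ge0.
Qed.

Lemma psdmx_conj (n p : nat) (M : 'M[R]_n) (V : 'M[R]_(n, p)) :
  psdmx M -> psdmx (V^T *m M *m V).
Proof.
move=> [MT M0]; split; first by rewrite !trmx_mul trmxK MT mulmxA.
by move=> v; have := M0 (V *m v); rewrite trmx_mul !mulmxA.
Qed.

Lemma psdmx_sum (n : nat) (I : finType) (M : I -> 'M[R]_n) :
  (forall i, psdmx (M i)) -> psdmx (\sum_i M i).
Proof.
move=> M0; apply: big_ind => //; last exact: psdmxD.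
by split; [rewrite trmx0|move=> v; rewrite mulmx0 mul0mx mxE].
Qed.

Lemma psdmxZ (n : nat) (a : R) (M : 'M[R]_n) : 0 <= a -> psdmx M -> psdmx (a *: M).
Proof.
move=> a0 [MT M0]; split; first by rewrite linearZ/= MT.
by move=> v; rewrite -scalemxAr -scalemxAl mxE mulr_ge0.
Qed.

Lemma psdmx1 (n : nat) : psdmx (1%:M : 'M[R]_n).
Proof.
split; first by rewrite trmx1.
by move=> v; rewrite mulmx1 mxE sumr_ge0// => i _; rewrite mxE -expr2 sqr_ge0.
Qed.

Lemma psdmx_diag_ge0 (n : nat) (M : 'M[R]_n) i : psdmx M -> 0 <= M i i.
Proof.
move=> [_ /(_ (delta_mx i 0))]; rewrite trmx_delta -rowE -colE.
by rewrite !mxE.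
Qed.

Lemma psdmx_trace_ge0 (n : nat) (M : 'M[R]_n) : psdmx M -> 0 <= \tr M.
Proof. by move=> M0; apply: sumr_ge0 => i _; apply: psdmx_diag_ge0. Qed.

(** After [l] iterations of the equation, [X] exceeds [Y = (F ^+ l)^T *m X *m F ^+ l] by a positive
    semidefinite sum. Hence the negated form of [X] at [v] is at most the modulus of the form of [Y]
    at [v], and these moduli have bounded partial sums over [l]. *)
Lemma dlyap_psd (n : nat) (F W : 'M[R]_n) : power_summable F -> psdmx W ->
  psdmx (dlyap F W).
Proof.
move=> FS W0; have [WT _] := W0; split; first exact: dlyap_sym.
move=> v; set X := dlyap F W; have XE : X = _ := dlyapP W FS.
have [B FB] := power_summable_conj X FS.
rewrite -oppr_le0.
apply: (ler_of_mulrn_bounded (B := sumnorm v * B * sumnorm v)) => k.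
have v0 := sumnorm_ge0 v.
apply: (@le_trans _ _ (\sum_(j < k) sumnorm v *
   sumnorm ((F ^+ j)^T *m X *m F ^+ j) * sumnorm v)); last first.
  by rewrite -mulr_suml -mulr_sumr ler_wpM2r// ler_wpM2l.
rewrite mulr_natl -[X in _ *+ X](card_ord k) -sumr_const; apply: ler_sum => l _.
pose Y := (F ^+ l)^T *m X *m F ^+ l.
apply: (@le_trans _ _ (sumnorm (v^T *m Y *m v))); last first.
  apply: le_trans (sumnormM _ _) _; rewrite ler_wpM2r//.
  by apply: le_trans (sumnormM _ _) _; rewrite sumnorm_tr.
apply: le_trans (ler_sumnorm _ 0 0); rewrite -normrN.
apply: le_trans (ler_norm _); rewrite lerN2.
rewrite [in leRHS](stein_conj_exp l XE) mulmxDr mulmxDl [leRHS]mxE lerDl.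
have [_] : psdmx (\sum_(j < l) (F ^+ j)^T *m W *m F ^+ j); last exact.
by apply: psdmx_sum => j; apply: psdmx_conj.
Qed.

Lemma eigenvalue_psd_ge0 (n : nat) (M : 'M[R]_n) a : psdmx M ->
  eigenvalue M a -> 0 <= a.
Proof.
move=> [_ M0] /eigenvalueP [v vM v0]; have := M0 v^T.
rewrite trmxK vM -scalemxAl mxE.
suff : 0 < (v *m v^T) 0 0 by move=> ?; rewrite pmulr_lge0.
rewrite mxE lt0r sumr_ge0 ?andbT; last first.
  by move=> i _; rewrite mxE -expr2 sqr_ge0.
apply: contra v0; rewrite psumr_eq0; last first.
  by move=> i _; rewrite mxE -expr2 sqr_ge0.
move=> /allP vi; apply/eqP/rowP => i; rewrite mxE.
have /= := vi i (mem_index_enum i).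
by rewrite mxE mulf_eq0 orbb => /eqP.
Qed.

End RealMatrices.

(** * Symmetric real matrices *)

Section Spectral.
Variable R : realType.
Set Implicit Arguments.
Unset Strict Implicit.

(* The complex unitary diagonalization of a real symmetric matrix, each
   eigenvector u = a + i b being replaced by the two real rows a and b. *)
Lemma symmetric_resolution (n : nat) (M : 'M[R]_n) : M^T = M ->
  exists (d : 'I_n -> R) (V : 'I_n -> 'M[R]_(1 + 1, n)),
    [/\ forall k, eigenvalue M (d k),
        M = \sum_k d k *: ((V k)^T *m V k) &
        1%:M = \sum_k (V k)^T *m V k].
Proof.
move=> MT; pose C := map_mx (real_complex R) M.
have Creal : C \is a realmx.
  by apply/mxOverP => i j; rewrite mxE; apply/complex_realP; exists (M i j).
have Csym : C \is symmetricmx.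
  by apply/is_hermitianmxP; rewrite expr0 scale1r map_mx_id// /C map_trmx MT.
have Cherm := realsym_hermsym Csym Creal.
pose P : 'M[R[i]]_n := spectralmx C; pose sp : 'rV[R[i]]_n := spectral_diag C.
have PU : P \is unitarymx := spectral_unitarymx C.
have CE : C = invmx P *m diag_mx sp *m P.
  exact/orthomx_spectralP/hermitian_normalmx.
have Punit := spectral_unit C.
have spreal k : real_complex R (complex.Re (sp 0 k)) = sp 0 k.
  by apply: RRe_real; move/mxOverP: (hermitian_spectral_diag_real Cherm); apply.
pose a k : 'rV[R]_n := \row_j complex.Re (P k j).
pose b k : 'rV[R]_n := \row_j complex.Im (P k j).
pose V k : 'M[R]_(1 + 1, n) := col_mx (a k) (b k).
(* For u = a + i b, the real part of conj(u_i) u_j is a_i a_j + b_i b_j, so the Gram matrix of the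
   two real rows is the real part of the complex rank-one term. *)
have VE k i j : ((V k)^T *m V k) i j = complex.Re (conjc (P k i) * P k j).
  rewrite /V tr_col_mx mul_row_col !mxE !big_ord1 !mxE.
  by case: (P k i) => x y; case: (P k j) => z t /=; ring.
exists (fun k => complex.Re (sp 0 k)), V; split.
(* Being an eigenvalue transfers between the reals and the complex numbers, so the complex row [k]
   of [P] serves as eigenvector. *)
- move=> k; rewrite -(eigenvalue_map (real_complex R)) /= spreal.
  apply/eigenvalueP; exists (row k P); last first.
    apply/eqP => /(congr1 (fun r => r *m invmx P)).
    rewrite mul0mx -row_mul mulmxV// => /rowP/(_ k)/eqP.
    by rewrite !mxE eqxx oner_eq0.
  rewrite -/C -row_mul {1}CE !mulmxA mulmxV// mul1mx row_mul.
  by rewrite row_diag_mx -scalemxAl -rowE.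
- apply/matrixP => i j.
  have -> : M i j = complex.Re (C i j : R[i]) by rewrite mxE.
  rewrite CE invmx_unitary// mul_mx_diag mxE summxE.
  rewrite (raddf_sum (@complex.Re R : Rcomplex R -> R)).
  apply: eq_bigr => k _; rewrite [RHS]mxE VE !mxE -(spreal k) -[Num.conj _]/(conjc _).
  by case: (conjc _) => x y; case: (P k j) => z t /=; ring.
- apply/matrixP => i j.
  have -> : (1%:M : 'M[R]_n) i j = complex.Re ((invmx P *m P) i j : R[i]).
    by rewrite mulVmx// !mxE; case: eqP.
  rewrite invmx_unitary// mxE summxE (raddf_sum (@complex.Re R : Rcomplex R -> R)).
  by apply: eq_bigr => k _; rewrite VE !mxE.
Qed.

Lemma psdmx_gram (n p : nat) (V : 'M[R]_(p, n)) : psdmx (V^T *m V).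
Proof. by rewrite -[V^T]mulmx1; apply/psdmx_conj/psdmx1. Qed.

(** Resolving [M] into nonnegative multiples of Gram matrices reduces the claim to tr(V N V^T) >= 0,
    by cyclicity of the trace. *)
Lemma psdmx_trace_mul_ge0 (n : nat) (M N : 'M[R]_n) :
  psdmx M -> psdmx N -> 0 <= \tr (M *m N).
Proof.
move=> M0 N0; have [d [V [dM -> _]]] := symmetric_resolution (proj1 M0).
rewrite mulmx_suml raddf_sum sumr_ge0// => k _ /=.
rewrite -scalemxAl mxtraceZ; apply: mulr_ge0.
  exact: eigenvalue_psd_ge0 (dM k).
rewrite -mulmxA mxtrace_mulC -[V k in X in X *m _]trmxK.
exact/psdmx_trace_ge0/psdmx_conj.
Qed.

Lemma eigenvalue_subr (n : nat) (M : 'M[R]_n) a b :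
  eigenvalue M b -> eigenvalue (M - a%:M) (b - a).
Proof.
move=> /eigenvalueP [v vM v0]; apply/eigenvalueP; exists v => //.
by rewrite mulmxBr vM mul_mx_scalar scalerBl.
Qed.

(** [M] and the identity are resolved by the same Gram matrices, so subtracting the smallest [d k0]
    leaves nonnegative coefficients. Positivity of this difference makes [d k0] a lower bound of all
    eigenvalues, hence the infimum. *)
Lemma lambda_minP (n : nat) (M : 'M[R]_n) : (0 < n)%N -> M^T = M ->
  eigenvalue M (lambda_min M) /\ psdmx (M - (lambda_min M)%:M).
Proof.
move=> n0 MT; have [d [V [dM ME VE]]] := symmetric_resolution MT.
have [k0 _ dk0] := @arg_minP _ _ _ (Ordinal n0) predT d isT.
have Mpsd : psdmx (M - (d k0)%:M).
  rewrite -scalemx1 [in X in X - _]ME VE scaler_sumr -sumrB.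
  apply: psdmx_sum => k; rewrite -scalerBl; apply: psdmxZ.
    by rewrite subr_ge0 dk0.
  exact: psdmx_gram.
suff -> : lambda_min M = d k0 by [].
have lb : lbound [set a | eigenvalue M a] (d k0).
  by move=> b /= Mb; rewrite -subr_ge0 (eigenvalue_psd_ge0 Mpsd)// eigenvalue_subr.
apply/eqP; rewrite eq_le; apply/andP; split.
  by apply: ge_inf; [exists (d k0)|exact: dM].
by apply: lb_le_inf => //; exists (d k0); exact: dM.
Qed.

Lemma lambda_min_gt0 (n : nat) (M : 'M[R]_n) : (0 < n)%N -> posdefmx M ->
  0 < lambda_min M.
Proof.
move=> n0 Mpos; have [/eigenvalueP [v vM v0] _] := lambda_minP n0 (proj1 Mpos).
rewrite lt0r (eigenvalue_psd_ge0 (posdef_psd Mpos)) ?andbT; last first.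
  by apply/eigenvalueP; exists v.
apply: contra_neq v0 => l0; apply/eqP; apply: contraT => v0.
have := proj2 Mpos v^T; rewrite trmxK vM l0 scale0r mul0mx mxE ltxx.
by apply; rewrite trmx_eq0.
Qed.

Lemma rayleigh_ge (n : nat) (M : 'M[R]_n) (v : 'cV[R]_n) : (0 < n)%N ->
  M^T = M -> lambda_min M * (v^T *m v) 0 0 <= (v^T *m M *m v) 0 0.
Proof.
move=> n0 MT; have [_ [_ /(_ v)]] := lambda_minP n0 MT.
by rewrite mulmxBr mulmxBl mul_mx_scalar -scalemxAl !mxE subr_ge0.
Qed.

End Spectral.

(** * Schur stability *)

Section SchurStable.
Variable R : realType.
Set Implicit Arguments.
Unset Strict Implicit.
Local Notation normc := (@Normc.normc R).

Lemma normc_ge0 (z : R[i]) : 0 <= normc z.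
Proof. by case: z => a b; apply: sqrtr_ge0. Qed.

Lemma normc_real (x : R) : normc (real_complex R x) = `|x|.
Proof. by rewrite /= expr0n addr0 sqrtr_sqr. Qed.

Definition abs_summable (y : nat -> R[i]) : Prop :=
  exists B, forall k, \sum_(j < k) normc (y j) <= B.

(** With S_k the partial sums of the moduli, S_k <= S_(k+1) <= |y_0| + B + |z| S_k; solving for S_k
    gives the bound. *)
Lemma abs_summable_recurrence (y : nat -> R[i]) (z : R[i]) : normc z < 1 ->
  abs_summable (fun k => y k.+1 - z * y k) -> abs_summable y.
Proof.
move=> z1 [B yB]; exists ((normc (y 0%N) + B) / (1 - normc z)) => k.
rewrite ler_pdivlMr ?subr_gt0// mulrBr mulr1 lerBlDr.
apply: (@le_trans _ _ (\sum_(j < k.+1) normc (y j))).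
  by rewrite big_ord_recr/= lerDl normc_ge0.
rewrite big_ord_recl/= -addrA lerD2l; apply: le_trans (lerD (yB k) (lexx _)).
rewrite mulrC mulr_sumr -big_split/=; apply: ler_sum => j _.
rewrite -Normc.normcM; apply: le_trans (le_normcD _ _).
by rewrite subrK.
Qed.

(* Factoring off one root of the annihilating polynomial at a time. *)
Lemma abs_summable_annihilated (n : nat) (F M : 'M[R[i]]_n.+1) (rs : seq R[i]) :
  all (fun z => normc z < 1) rs ->
  horner_mx F (\prod_(z <- rs) ('X - z%:P)) *m M = 0 ->
  forall i j, abs_summable (fun k => (F ^+ k *m M) i j).
Proof.
elim: rs M => [|z rs IH] M.
  rewrite big_nil rmorph1 mul1mx => _ -> i j; exists 0 => k.
  by rewrite big1// => l _; rewrite mulmx0 mxE Normc.normc0.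
move=> /= /andP[z1 rs1]; rewrite big_cons mulrC rmorphM/= -mulmxE -mulmxA.
(* The induction hypothesis is applied to (F - z) M, whose sequence is exactly y_(k+1) - z y_k for
   the sequence y of [M]. *)
move=> /(IH _ rs1) FM i j; apply: (abs_summable_recurrence z1).
have [B FB] := FM i j; exists B => k; apply: le_trans (FB k).
apply: ler_sum => l _; rewrite le_eqVlt; apply/orP; left; apply/eqP.
congr normc; rewrite rmorphB/= horner_mx_X horner_mx_C.
rewrite mulmxBl mulmxBr mul_scalar_mx -scalemxAr exprSr -mulmxE -mulmxA.
by rewrite !mxE.
Qed.

Lemma normc_eigenvalue_lt1 (n : nat) (F : 'M[R]_n) (z : R[i]) :
  schur_stable F -> eigenvalue (map_mx (real_complex R) F) z -> normc z < 1.
Proof.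
move=> F1 Fz; apply: le_lt_trans F1; apply: ub_le_sup; last by exists z.
have [rs rsE] := closed_field_poly_normal (char_poly (map_mx (real_complex R) F)).
(* [sup] dominates its set only once that set is bounded; the sum of the moduli of all
   characteristic roots is a bound. *)
exists (\sum_(x <- rs) normc x) => _ [x /= Fx <-].
have xrs : x \in rs.
  move: Fx; rewrite eigenvalue_root_char rsE.
  by rewrite (monicP (char_poly_monic _)) scale1r root_prod_XsubC.
rewrite (big_rem x)//= lerDl sumr_ge0// => y _; exact: normc_ge0.
Qed.

Lemma schur_power_summable (n : nat) (F : 'M[R]_n) :
  schur_stable F -> power_summable F.
Proof.
case: n F => [|n] F F1.
  by exists 0 => k; rewrite big1// => j _; rewrite /sumnorm big_ord0.
pose C := map_mx (real_complex R) F.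
have [rs rsE] := closed_field_poly_normal (char_poly C).
rewrite (monicP (char_poly_monic _)) scale1r in rsE.
have rs1 : all (fun z => normc z < 1) rs.
  apply/allP => z zrs; apply: (normc_eigenvalue_lt1 F1).
  by rewrite eigenvalue_root_char rsE root_prod_XsubC.
have CH : horner_mx C (\prod_(z <- rs) ('X - z%:P)) *m 1%:M = 0.
  by rewrite -rsE Cayley_Hamilton mul0mx.
have summ i j : exists B, forall k, \sum_(l < k) `|(F ^+ l) i j| <= B.
  have [B FB] := abs_summable_annihilated rs1 CH i j; exists B => k.
  apply: le_trans (FB k); apply: ler_sum => l _.
  by rewrite mulmx1 -(rmorphXn (map_mx (real_complex R))) mxE normc_real.
have /choice [B FB] (ij : 'I_n.+1 * 'I_n.+1) := summ ij.1 ij.2.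
exists (\sum_i \sum_j B (i, j)) => k; rewrite /sumnorm exchange_big.
apply: ler_sum => i _; rewrite exchange_big; apply: ler_sum => j _.
exact: FB (i, j) k.
Qed.

End SchurStable.

(** * The cost difference of one plant *)

(** The left side is the residual of [P] in the Lyapunov equation of the gain [K - D], whose closed
    loop is [F + B *m D]. The equation of [P] cancels all terms free of [D]. *)
Lemma stein_completion (R : realType) (n m : nat) (P Q F : 'M[R]_n)
    (B : 'M[R]_(n, m)) (Rc : 'M[R]_m) (K D : 'M[R]_(m, n)) :
  P = F^T *m P *m F + (Q + K^T *m Rc *m K) ->
  P - (F + B *m D)^T *m P *m (F + B *m D) -
      (Q + (K - D)^T *m Rc *m (K - D)) =
  D^T *m (Rc *m K - B^T *m P *m F) + (K^T *m Rc - F^T *m P *m B) *m D -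
    D^T *m (Rc + B^T *m P *m B) *m D.
Proof.
move=> PE; rewrite {1}PE [(F + _)^T]linearD [(K - D)^T]linearB/= trmx_mul.
rewrite !(mulmxDl, mulmxDr, mulmxN, mulNmx, mulmxA).
apply/matrixP => i j.
have entryD (U V : 'M[R]_n) : (U + V) i j = U i j + V i j by rewrite mxE.
have entryN (U : 'M[R]_n) : (- U) i j = - U i j by rewrite mxE.
by rewrite !(entryD, entryN); ring.
Qed.

Section CostDifference.
Variables (R : realType) (n m : nat).
Set Implicit Arguments.
Unset Strict Implicit.
Variables (A : 'M[R]_n) (B : 'M[R]_(n, m)).
Variables (Q : 'M[R]_n) (Rc : 'M[R]_m) (S0 : 'M[R]_n).
Hypotheses (Qpsd : psdmx Q) (Rpsd : psdmx Rc) (Spsd : psdmx S0).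

(** The Stein operators of [F] and of [F^T] are adjoint for the trace pairing. *)
Lemma trace_dlyap (F W V : 'M[R]_n) : power_summable F ->
  \tr (dlyap F W *m V) = \tr (W *m dlyap F^T V).
Proof.
move=> FS; have FTS := power_summable_tr FS.
have PE := dlyapP W FS; have XE := dlyapP V FTS; rewrite trmxK in XE.
move: (dlyap F W) (dlyap F^T V) PE XE => P X PE XE.
have -> : V = X - F *m X *m F^T by rewrite {1}XE addrC addKr.
have -> : W = P - F^T *m P *m F by rewrite {1}PE addrC addKr.
rewrite mulmxBr mulmxBl !linearB/=; congr (_ - _).
rewrite -!mulmxA [RHS]mxtrace_mulC !mulmxA [LHS]mxtrace_mulC.
by rewrite -!mulmxA mxtrace_mulC !mulmxA.
Qed.

Variables K K' : 'M[R]_(m, n).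
Hypotheses (Kstab : stabilizes A B K) (Kstab' : stabilizes A B K').
Let D := K - K'.
Let P := Pmx A B Q Rc K.
Let X := Sigmamx A B S0 K'.
Let H := Hmx A B Q Rc K.
Let E := Emx A B Q Rc K.

Lemma stage_cost_psd : psdmx (Q + K^T *m Rc *m K).
Proof. exact/psdmxD/psdmx_conj. Qed.

Lemma Pmx_psd : psdmx P.
Proof. apply: dlyap_psd; last exact: stage_cost_psd.
exact: schur_power_summable Kstab. Qed.

Lemma Sigmamx_psd : psdmx X.
Proof. apply: dlyap_psd Spsd.
exact: power_summable_tr (schur_power_summable Kstab'). Qed.

Lemma Sigmamx_sub_psd : psdmx (X - S0).
Proof.
rewrite /X /Sigmamx dlyapP; last first.
  exact: power_summable_tr (schur_power_summable Kstab').
by rewrite addrK; apply: psdmx_conj Sigmamx_psd.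
Qed.

Lemma Hmx_sub_psd : psdmx (H - Rc).
Proof. by rewrite /H /Hmx addrC addKr; apply: psdmx_conj Pmx_psd. Qed.

Lemma plant_cost_diff :
  plant_cost A B Q Rc S0 K - plant_cost A B Q Rc S0 K' =
  2 * \tr ((E *m X)^T *m D) - \tr (D^T *m H *m D *m X).
Proof.
pose F := Acl A B K; pose F' := Acl A B K'.
have FS : power_summable F := schur_power_summable Kstab.
have FS' : power_summable F' := schur_power_summable Kstab'.
have PT : P^T = P := proj1 Pmx_psd.
have XT : X^T = X := proj1 Sigmamx_psd.
have RT : Rc^T = Rc := proj1 Rpsd.
have PE : P = F^T *m P *m F + (Q + K^T *m Rc *m K) := dlyapP _ FS.
(* [P] trivially solves the Lyapunov equation of [F'] with source [P - F'^T *m P *m F'], so duality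
   expresses the cost of [K] through the covariance of [K']. *)
have PX : \tr (P *m S0) = \tr ((P - F'^T *m P *m F') *m X).
  rewrite -(trace_dlyap _ _ FS'); congr (\tr (_ *m _)).
  apply: (dlyap_unique FS'); last exact: dlyapP.
  by rewrite addrC subrK.
have FD : F' = F + B *m D.
  by rewrite /F /F' /Acl /D mulmxBr addrA subrK.
have KD : K' = K - D by rewrite /D opprB addrC subrK.
have EE : E = Rc *m K - B^T *m P *m F.
  rewrite /E /Emx /Hmx -/P /F /Acl mulmxBr mulmxDl opprB addrA !mulmxA.
  by rewrite addrAC.
have ET : E^T = K^T *m Rc - F^T *m P *m B.
  by rewrite EE linearB/= !trmx_mul trmxK PT RT mulmxA.
have -> : plant_cost A B Q Rc S0 K' = \tr ((Q + K'^T *m Rc *m K') *m X).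
  exact: trace_dlyap.
rewrite /plant_cost -/P PX -linearB/= -mulmxBl.
have -> : P - F'^T *m P *m F' - (Q + K'^T *m Rc *m K') =
    D^T *m E + E^T *m D - D^T *m H *m D.
  by rewrite FD KD ET EE /H /Hmx -/P; apply: stein_completion.
rewrite mulmxBl linearB/= mulmxDl linearD/=; congr (_ - _).
rewrite trmx_mul XT mulr_natl mulr2n; congr (_ + _); last first.
  by rewrite mxtrace_mulC mulmxA.
by rewrite -[LHS]mxtrace_tr !trmx_mul XT trmxK mulmxA.
Qed.

End CostDifference.

(** * Gradient dominance *)

Section GradientDominance.
Set Implicit Arguments.
Unset Strict Implicit.

(** Transitivity of the Loewner order, through [N]. *)
Lemma lambda_min_sub_psd (R : realType) (n : nat) (M N : 'M[R]_n) :
  (0 < n)%N -> N^T = N -> psdmx (M - N) -> psdmx (M - (lambda_min N)%:M).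
Proof.
move=> n0 NT MN; have [_ N0] := lambda_minP n0 NT.
by have := psdmxD MN N0; rewrite addrA subrK.
Qed.

Lemma plant_gradient_dominance (R : realType) (n m : nat)
    (A : 'M[R]_n) (B : 'M[R]_(n, m)) (Q : 'M[R]_n) (Rc : 'M[R]_m)
    (S0 : 'M[R]_n) (K K' : 'M[R]_(m, n)) :
  (0 < n)%N -> (0 < m)%N -> posdefmx Q -> posdefmx Rc -> posdefmx S0 ->
  stabilizes A B K -> stabilizes A B K' ->
  plant_cost A B Q Rc S0 K - plant_cost A B Q Rc S0 K' +
    lambda_min S0 * lambda_min Rc * \tr ((K - K')^T *m (K - K')) <=
  2 * \tr ((Emx A B Q Rc K *m Sigmamx A B S0 K')^T *m (K - K')).
Proof.
move=> n0 m0 Qpos Rpos Spos Kstab Kstab'.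
have Q0 := posdef_psd Qpos; have R0 := posdef_psd Rpos.
have S00 := posdef_psd Spos.
rewrite (plant_cost_diff Q0 R0 S00 Kstab Kstab') -addrA gerDl addrC subr_le0.
set D := K - K'; set H := Hmx _ _ _ _ _; set X := Sigmamx _ _ _ _.
have H0 : psdmx (H - (lambda_min Rc)%:M).
  exact: lambda_min_sub_psd m0 (proj1 R0) (Hmx_sub_psd Q0 R0 Kstab).
have X0 : psdmx (X - (lambda_min S0)%:M).
  exact: lambda_min_sub_psd n0 (proj1 S00) (Sigmamx_sub_psd S00 Kstab').
have lR := lambda_min_gt0 m0 Rpos.
have X1 : psdmx X := Sigmamx_psd S00 Kstab'.
clearbody D H X.
rewrite mulrC mulrA [_ * lambda_min Rc]mulrC.
(* The two matrix bounds are used in turn: first [X] is bounded below against [D^T *m D], then [H],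
   conjugated by [D], against [X]. *)
apply: (@le_trans _ _ (lambda_min Rc * \tr (D^T *m D *m X))).
  apply: ler_wpM2l; first exact: ltW.
  rewrite -subr_ge0 [_ * lambda_min S0]mulrC.
  have := psdmx_trace_mul_ge0 (psdmx_gram D) X0.
  by rewrite mulmxBr mul_mx_scalar linearB/= mxtraceZ.
have := psdmx_trace_mul_ge0 (psdmx_conj D H0) X1.
rewrite mulmxBr mulmxBl mulmxBl linearB/= subr_ge0 mul_mx_scalar.
by rewrite -!scalemxAl mxtraceZ.
Qed.

(** * Averaging over the grid and passing to tuples *)

Lemma frobenius_sqr (R : realType) (p q : nat) (M : 'M[R]_(p, q)) :
  \tr (M^T *m M) = \sum_i \sum_j M i j ^+ 2.
Proof.
rewrite /mxtrace exchange_big; apply: eq_bigr => j _.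
by rewrite mxE; apply: eq_bigr => i _; rewrite mxE expr2.
Qed.

Lemma tuple_norm_sqr (R : realType) (N p q : nat)
    (X : {ffun 'I_N -> 'M[R]_(p, q)}) :
  tuple_norm X ^+ 2 = \sum_i \tr ((X i)^T *m X i).
Proof.
rewrite sqr_sqrtr// sumr_ge0// => i _; rewrite frobenius_sqr.
by apply: sumr_ge0 => j _; apply: sumr_ge0 => k _; exact: sqr_ge0.
Qed.

Lemma blendB (R : realType) (T : Type) (N p q : nat) (w : 'I_N -> T -> R)
    (X Y : {ffun 'I_N -> 'M[R]_(p, q)}) (r : T) :
  blend w (X - Y) r = blend w X r - blend w Y r.
Proof.
by rewrite /blend -sumrB; apply: eq_bigr => i _; rewrite !ffunE scalerBr.
Qed.

Lemma Gw_form (R : realType) (T : topologicalType) (n m N S : nat)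
    (D : scheduled_lqr R T n m N S) (x : 'cV[R]_N) :
  (x^T *m Gw D *m x) 0 0 =
  \sum_s nu D s * (\sum_i wt D i (grid D s) * x i 0) ^+ 2.
Proof.
rewrite /Gw mulmx_sumr mulmx_suml summxE; apply: eq_bigr => s _.
rewrite -scalemxAr -scalemxAl mxE; congr (_ * _).
set w := wvec _ _; rewrite -mulmxA -mulmxA mulmxA mxE big_ord1.
have -> : (x^T *m w) 0 0 = (w^T *m x) 0 0.
  by rewrite -[x in RHS]trmxK -trmx_mul [RHS]mxE.
rewrite -expr2 mxE; congr (_ ^+ 2); apply: eq_bigr => i _.
by rewrite !mxE.
Qed.

(** Both sides split over matrix positions. At position (j, k) the entries of the tuple form a
    vector x, the blended entry is w^T x, and the claim is the Rayleigh bound for [Gw D] at x. *)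
Lemma blend_norm_ge (R : realType) (T : topologicalType) (n m N S : nat)
    (D : scheduled_lqr R T n m N S) (p q : nat)
    (X : {ffun 'I_N -> 'M[R]_(p, q)}) :
  (0 < N)%N -> posdefmx (Gw D) ->
  lambda_min (Gw D) * tuple_norm X ^+ 2 <=
  \sum_s nu D s * \tr ((blend (wt D) X (grid D s))^T *m
                       blend (wt D) X (grid D s)).
Proof.
move=> N0 [GT _]; rewrite tuple_norm_sqr.
under eq_bigr do rewrite frobenius_sqr.
under [in leRHS]eq_bigr do rewrite frobenius_sqr mulr_sumr.
rewrite exchange_big [leRHS]exchange_big mulr_sumr; apply: ler_sum => j _.
under [in leRHS]eq_bigr do rewrite mulr_sumr.
rewrite exchange_big [leRHS]exchange_big mulr_sumr; apply: ler_sum => k _.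
have := rayleigh_ge (\col_i X i j k) N0 GT; rewrite Gw_form mxE.
have -> : \sum_l (\col_i X i j k)^T 0 l * (\col_i X i j k) l 0 =
    \sum_i X i j k ^+ 2 by apply: eq_bigr => i _; rewrite !mxE expr2.
move=> /le_trans; apply; apply: ler_sum => s _; rewrite /blend summxE.
rewrite le_eqVlt; apply/orP; left; apply/eqP; congr (_ * _ ^+ 2).
by apply: eq_bigr => i _; rewrite !mxE.
Qed.

(** By linearity the weight of block [i] moves from the gradient onto [X i], which reassembles the
    deployed direction and separates the plants. *)
Lemma star_grad_dot (R : realType) (T : topologicalType) (n m N S : nat)
    (D : scheduled_lqr R T n m N S) (Kstar K X : {ffun 'I_N -> 'M[R]_(m, n)}) :
  tuple_dot (star_grad D Kstar K) X =
  \sum_s nu D s * (2 * \tr ((E_at D K s *m Sigma_at D Kstar s)^T *m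
                            blend (wt D) X (grid D s))).
Proof.
rewrite /tuple_dot.
transitivity (\sum_i \sum_s nu D s * (2 * (wt D i (grid D s) *
    \tr ((E_at D K s *m Sigma_at D Kstar s)^T *m X i)))).
  apply: eq_bigr => i _; rewrite ffunE linearZ/= -scalemxAl mxtraceZ.
  rewrite raddf_sum mulmx_suml raddf_sum mulr_sumr; apply: eq_bigr => s _ /=.
  by rewrite linearZ/= -scalemxAl mxtraceZ; ring.
rewrite exchange_big; apply: eq_bigr => s _ /=.
rewrite -mulr_sumr -mulr_sumr /blend mulmx_sumr raddf_sum.
by congr (_ * (_ * _)); apply: eq_bigr => i _ /=; rewrite -scalemxAr mxtraceZ.
Qed.

End GradientDominance.

Theorem mainTheorem2 (R : realType) (T : topologicalType) (n m N S : nat)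
    (n_gt0 : (0 < n)%N) (m_gt0 : (0 < m)%N)
    (D : scheduled_lqr R T n m N S)
    (nu_gt0 : forall s, 0 < nu D s)
    (nu_sum1 : \sum_s nu D s = 1)
    (wt_cont : forall i, continuous (wt D i))
    (wt_ge0 : forall i r, 0 <= wt D i r)
    (wt_sum1 : forall r, \sum_i wt D i r = 1)
    (Q_posdef : posdefmx (Qcost D))
    (R_posdef : posdefmx (Rcost D))
    (Sigma0_posdef : posdefmx (Sigma0 D))
    (feasible_neq0 : feasible D !=set0)
    (Gw_posdef : posdefmx (Gw D))
    (Kstar : {ffun 'I_N -> 'M[R]_(m, n)})
    (Kstar_min : minimizer D Kstar) :
  let lam := lambda_min (Gw D) * lambda_min (Sigma0 D) * lambda_min (Rcost D) in
  0 < lam /\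
  forall K : {ffun 'I_N -> 'M[R]_(m, n)}, feasible D K ->
    tuple_dot (star_grad D Kstar K) (K - Kstar) >=
      (cost D K - cost D Kstar) + lam * tuple_norm (K - Kstar) ^+ 2.
Proof.
(* Without vertices the weights at a grid point would have empty sum 0 instead of 1; so there would
   be no grid point, and the [nu D s] could not sum to 1. *)
have N_gt0 : (0 < N)%N.
  rewrite lt0n; apply: contra_eq_neq nu_sum1 => N0.
  rewrite big1 1?eq_sym ?oner_eq0// => s _; have := wt_sum1 (grid D s).
  rewrite big1; first by move=> /esym/eqP; rewrite oner_eq0.
  by move=> i _; have := ltn_ord i; rewrite [X in (_ < X)%N]N0.
have lG := lambda_min_gt0 N_gt0 Gw_posdef.
have lS := lambda_min_gt0 n_gt0 Sigma0_posdef.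
have lR := lambda_min_gt0 m_gt0 R_posdef.
split; first by rewrite !mulr_gt0.
move=> K Kfeas; have [Ksfeas _] := Kstar_min.
rewrite star_grad_dot.
apply: (@le_trans _ _ (cost D K - cost D Kstar +
    lambda_min (Sigma0 D) * lambda_min (Rcost D) *
    \sum_s nu D s * \tr ((blend (wt D) (K - Kstar) (grid D s))^T *m
                         blend (wt D) (K - Kstar) (grid D s)))).
  rewrite lerD2l -(mulrA (lambda_min (Gw D))) [lambda_min (Gw D) * _]mulrC -[leLHS]mulrA.
  apply: ler_wpM2l.
    by rewrite mulr_ge0// ltW.
  by have := blend_norm_ge (K - Kstar) N_gt0 Gw_posdef.
rewrite /cost -sumrB mulr_sumr -big_split/=; apply: ler_sum => s _.
rewrite mulrCA -mulrBr -mulrDr blendB; apply: ler_wpM2l; first exact: ltW.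
exact: plant_gradient_dominance.
Qed.
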